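(* Let $c, k \in \mathbb{R}$ satisfy $c > 2k > 0$. Then there exists, up to translations in $\xi$, a unique (smooth) solitary wave $\phi(\xi; c)$ of speed $c$ of the Degasperis-Procesi equation $$m_t + 2k u_x + 3 m u_x + u m_x = 0,\qquad m = u - u_{xx},\quad x \in \mathbb{R},\ t>0,$$ and its maximum height $\phi_{max} := \max_{\xi\in\mathbb{R}} \phi(\xi;c)$ satisfies $$\frac{c-2k}{4} < \phi_{max} < c - 2k.$$ In addition, the function $\phi(\cdot; c)$ can be taken (by a suitable choice of translate) to be even and strictly monotonically increasing from $0$ to $\phi_{max}$ for negative values of $\xi$ (i.e. strictly increasing on $(-\infty,0)$, with limit $0$ as $\xi \to -\infty$ and maximum $\phi_{max}$ attained at $\xi=0$).
   Context: A solution $u(t,x)$ of the equation is a traveling wave if there exist a real number $c$ (the speed) and a function $\phi:\mathbb{R}\to\mathbb{R}$ with $u(t,x) = \phi(x-ct)$. A traveling wave $\phi(x-ct)$ is a solitary wave if there exists $\xi_0 \in\mathbb{R}$ such that: (i) $\max_{\xi\in\mathbb{R}}\phi(\xi) = \phi(\xi_0)$ and $\lim_{\xi\to\pm\infty}\phi(\xi) = 0$; (ii) $\phi$ is strictly increasing on $(-\infty,\xi_0)$ and strictly decreasing on $(\xi_0,\infty)$. Solitary waves are understood here to be smooth (classical) solutions. In terms of $u$ the equation reads $u_t - u_{xxt} + 2k u_x - 3 u_x u_{xx} - u u_{xxx} + 4 u u_x = 0$. *)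

(* Defs.v *)
(* Stdlib's real numbers with Coquelicot. *)
From Stdlib Require Import Reals.
From Coquelicot Require Import Coquelicot.
Open Scope R_scope.

(* [ex_derive_n f n x] alone only says that the total function [Derive_n f (n-1)]
   is differentiable at x, hence the quantification over all orders. *)
Definition smooth (f : R -> R) : Prop :=
  forall (n : nat) (x : R), ex_derive_n f n x.

Definition momentum (u : R -> R -> R) (t x : R) : R :=
  u t x - Derive_n (u t) 2 x.

(* u is applied as [u t x].  The existence of the partial derivatives is part of
   the definition, because [Derive] is total. *)
Definition DP_solution (k : R) (u : R -> R -> R) : Prop :=
  forall t x : R, 0 < t ->
    (forall n : nat, (n <= 3)%nat -> ex_derive_n (u t) n x) /\
    ex_derive (fun s => momentum u s x) t /\
    Derive (fun s => momentum u s x) t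
      + 2 * k * Derive (u t) x
      + 3 * momentum u t x * Derive (u t) x
      + u t x * Derive (momentum u t) x = 0.

Definition traveling_wave (k c : R) (phi : R -> R) : Prop :=
  DP_solution k (fun t x => phi (x - c * t)).

Definition is_max (f : R -> R) (M : R) : Prop :=
  (exists x : R, f x = M) /\ (forall x : R, f x <= M).

Definition increasing_below (f : R -> R) (a : R) : Prop :=
  forall x y : R, x < y -> y < a -> f x < f y.

Definition decreasing_above (f : R -> R) (a : R) : Prop :=
  forall x y : R, a < x -> x < y -> f y < f x.

(* Smoothness of u(t,x) = phi(x - ct) in (t,x) amounts to smoothness of phi. *)
Definition solitary_wave (k c : R) (phi : R -> R) : Prop :=
  smooth phi /\
  traveling_wave k c phi /\
  exists xi0 : R,
    is_max phi (phi xi0) /\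
    is_lim phi p_infty 0 /\
    is_lim phi m_infty 0 /\
    increasing_below phi xi0 /\
    decreasing_above phi xi0.

(* Main.v *)
(* The profile equation integrates to [(c - phi)^3 (m + 2k/3) = const], and the decay
   at infinity forces the constant to be [2 k c^3 / 3]; hence [phi < c] and
   [phi'' = force c k phi] with a Lipschitz force. The energy of this equation at
   the level of the rest point 0 is
   [phi'^2 (c - phi)^2 = phi^2 (M - phi) (N - phi)] with [0 < M < c < N], so the crest
   of any solitary wave has height [M], and uniqueness of the initial value problem
   at the crest gives uniqueness up to translation. Conversely the energy equation
   is solved explicitly after the change of variable [dz / dxi = sqrt (M N) / (c - phi)]. *)
Require Import Defs.
From Stdlib Require Import Reals Lra.
From Coquelicot Require Import Coquelicot.
Open Scope R_scope.

(** * Mean value theorem and a criterion for smoothness *)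

Lemma mean_value (f df : R -> R) (hf : forall x, is_derive f x (df x)) (a b : R) :
  exists z, Rmin a b <= z <= Rmax a b /\ f b - f a = df z * (b - a).
Proof.
  apply MVT_gen; intros x _; [apply hf |].
  apply continuity_pt_filterlim, (@ex_derive_continuous R_AbsRing R_NormedModule f x).
  eexists; apply hf.
Qed.

Lemma mean_value_lt (f df : R -> R) (hf : forall x, is_derive f x (df x)) (a b : R) :
  a < b -> exists z, a <= z <= b /\ f b - f a = df z * (b - a).
Proof.
  intros hab; destruct (mean_value f df hf a b) as [z [hz e]].
  rewrite Rmin_left, Rmax_right in hz by lra; eauto.
Qed.

Lemma zero_derivative_constant (f : R -> R) :
  (forall x, is_derive f x 0) -> forall x y, f x = f y.
Proof.
  intros hf x y; destruct (mean_value f (fun _ => 0) hf y x) as [z [_ e]]; lra.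
Qed.

(** By induction each iterated derivative agrees pointwise with a member of [S]. Smoothness can thus
    be proved without a formula for the n-th derivative. *)
Lemma smooth_of_derivation_closed (S : (R -> R) -> Prop) :
  (forall f, S f -> exists g, S g /\ forall x, is_derive f x (g x)) ->
  forall f, S f -> smooth f.
Proof.
  intros hS f hf.
  assert (D : forall n, exists g, S g /\ forall x, Derive_n f n x = g x).
  { induction n as [| n [g [hg e]]]; [exists f; auto |].
    destruct (hS g hg) as [g' [hg' d]]; exists g'; split; [exact hg' |].
    intros x; simpl; rewrite (Derive_ext _ _ x e); apply is_derive_unique, d. }
  intros [| n] x; [exact I |].
  destruct (D n) as [g [hg e]]; destruct (hS g hg) as [g' [_ d]].
  simpl; apply ex_derive_ext with g; [intros t; symmetry; apply e |].
  eexists; apply d.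
Qed.

Lemma smooth_is_derive (f : R -> R) (n : nat) (x : R) :
  smooth f -> is_derive (Derive_n f n) x (Derive_n f (S n) x).
Proof. intros hf; apply Derive_correct, (hf (S n)). Qed.

(** * Global solution of a scalar autonomous equation *)

(** Separation of variables: [Y] is the inverse of the primitive [H] of [h] vanishing at 0. The
    bound [lo] makes [H] a bijection of the line, [hi] gives the growth of [Y], and evenness of [h]
    makes [H], hence [Y], odd. *)
Lemma autonomous_solution (h : R -> R) (lo hi : R) :
  0 < lo -> (forall y, continuous h y) -> (forall y, lo <= h y <= hi) ->
  (forall y, h (- y) = h y) ->
  exists Y : R -> R,
    (forall x, is_derive Y x (/ h (Y x))) /\
    (forall x, Y (- x) = - Y x) /\
    forall x, Rabs x <= hi * Rabs (Y x).
Proof.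
  intros hlo hcont hb heven.
  set (H := RInt h 0).
  assert (dH : forall y, is_derive H y (h y)).
  { intros y; apply is_derive_RInt with (a := 0); [| apply hcont].
    apply filter_forall; intros z; apply (@RInt_correct R_CompleteNormedModule).
    apply (@ex_RInt_continuous R_CompleteNormedModule); intros; apply hcont. }
  assert (H0 : H 0 = 0) by apply (@RInt_point R_CompleteNormedModule).
  assert (mv : forall y z, exists w, Rmin y z <= w <= Rmax y z
                 /\ H z - H y = h w * (z - y)) by (apply mean_value, dH).
  assert (lower : forall y z, lo * Rabs (z - y) <= Rabs (H z - H y)).
  { intros y z; destruct (mv y z) as [w [_ e]]; specialize (hb w).
    rewrite e, Rabs_mult, (Rabs_right (h w)) by lra.
    apply Rmult_le_compat_r; [apply Rabs_pos | lra]. }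
  assert (inj : forall y z, H y = H z -> y = z).
  { intros y z e; specialize (lower y z); rewrite e, Rminus_diag, Rabs_R0 in lower.
    assert (Rabs (z - y) <= 0) by nra.
    assert (~ z - y <> 0) by (intros n; apply Rabs_pos_lt in n; lra); lra. }
  assert (cH : continuity H).
  { intros y; apply continuity_pt_filterlim.
    apply (@ex_derive_continuous R_AbsRing R_NormedModule); eexists; apply dH. }
  assert (odd : forall y, H (- y) = - H y).
  { intros y.
    enough (H (- y) + H y = H (- 0) + H 0) by (rewrite Ropp_0 in *; lra).
    apply (zero_derivative_constant (fun y => H (- y) + H y)); intros z.
    evar_last; [apply (@is_derive_plus R_AbsRing R_NormedModule); [| apply dH] |].
    apply (is_derive_comp H); [apply dH | apply @is_derive_opp, is_derive_id].
    unfold plus, scal, opp, one; simpl; unfold mult; simpl; rewrite heven; ring. }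
  assert (surj : forall x, {y | H y = x}).
  { intros x.
    assert (hx : 0 <= Rabs x) by apply Rabs_pos.
    (* Since [H r >= lo * r >= Rabs x] and [H] is odd, the value [x] is taken on [[-r, r]]. *)
    set (r := Rabs x / lo + 1).
    assert (hr : 0 < r) by (unfold r; assert (0 <= Rabs x / lo) by (apply Rdiv_le_0_compat; lra); lra).
    assert (lr : Rabs x <= lo * r) by (unfold r; field_simplify; lra).
    assert (Hr : Rabs x <= H r).
    { destruct (mv 0 r) as [w [_ e]]; specialize (hb w); nra. }
    assert (hx' := Rle_abs x); assert (hx'' := Rle_abs (- x)); rewrite Rabs_Ropp in hx''.
    destruct (IVT_cor (fun y => H y - x) (- r) r) as [y [_ e]];
      [apply continuity_minus; [exact cH | apply continuity_const; intros ? ?; reflexivity]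
      | lra | rewrite odd; nra |].
    exists y; simpl in e; lra. }
  set (Y := fun x => proj1_sig (surj x)).
  assert (HY : forall x, H (Y x) = x) by (intros x; apply (proj2_sig (surj x))).
  exists Y; split; [| split].
  (* The difference quotient of [Y] equals [/ h w] for some [w] between [Y x] and [Y (x + t)]. By
     [lower], a step shorter than [lo * d] keeps [w] within [d] of [Y x], where continuity of [/ h]
     applies. *)
  - intros x; apply is_derive_Reals; intros eps heps.
    assert (ci : continuous (fun y => / h y) (Y x)).
    { apply continuous_comp with (g := Rinv); [apply hcont |].
      apply continuous_Rinv; specialize (hb (Y x)); lra. }
    destruct (proj1 (filterlim_locally _ _) ci (mkposreal eps heps)) as [d hd].
    exists (mkposreal (lo * d) (Rmult_lt_0_compat _ _ hlo (cond_pos d))); simpl.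
    intros t ht0 ht.
    destruct (mv (Y x) (Y (x + t))) as [w [hw e]]; rewrite !HY in e.
    assert (bt := lower (Y x) (Y (x + t))); rewrite !HY in bt.
    replace (x + t - x) with t in * by ring.
    assert (near : Rabs (Y (x + t) - Y x) < d) by nra.
    assert (hhw := hb w).
    replace ((Y (x + t) - Y x) / t) with (/ h w).
    2:{ apply Rmult_eq_reg_r with (h w * t); [| apply Rmult_integral_contrapositive; lra].
        rewrite e at 1; field; lra. }
    apply (hd w); change (Rabs (w - Y x) < d).
    revert hw near; unfold Rmin, Rmax; destruct Rle_dec; unfold Rabs;
      repeat destruct Rcase_abs; lra.
  - intros x; apply inj; rewrite odd, !HY; reflexivity.
  - intros x; destruct (mv 0 (Y x)) as [w [_ e]]; rewrite HY, H0, !Rminus_0_r in e.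
    specialize (hb w); rewrite e at 1; rewrite Rabs_mult, (Rabs_right (h w)) by lra.
    apply Rmult_le_compat_r; [apply Rabs_pos | lra].
Qed.

(** * Reduction to an ordinary differential equation *)

(** Along [x - c * t] the time derivative of the momentum is [- c] times its space derivative, so
    the two transport terms combine into the factor [phi - c]. *)
Lemma traveling_wave_ode (k c : R) (phi : R -> R) :
  smooth phi ->
  traveling_wave k c phi <->
  forall x,
    (phi x - c) * (Derive_n phi 1 x - Derive_n phi 3 x)
      + (3 * (phi x - Derive_n phi 2 x) + 2 * k) * Derive_n phi 1 x = 0.
Proof.
  intros hs.
  assert (d := fun n x => smooth_is_derive phi n x hs).
  set (u := fun t x => phi (x - c * t)).
  assert (Du : forall n t x, Derive_n (u t) n x = Derive_n phi n (x - c * t)).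
  { intros n t x; apply (Derive_n_comp_trans phi n x (- (c * t))). }
  assert (Eu : forall n t x, ex_derive_n (u t) n x).
  { intros n t x; apply (ex_derive_n_comp_trans phi n x (- (c * t))), hs. }
  set (m := fun x => phi x - Derive_n phi 2 x).
  assert (dm : forall x, is_derive m x (Derive_n phi 1 x - Derive_n phi 3 x)).
  { intros x; apply (@is_derive_minus R_AbsRing R_NormedModule); [apply (d 0%nat) | apply (d 2%nat)]. }
  assert (Em : forall t x, momentum u t x = m (x - c * t)).
  { intros t x; unfold momentum; rewrite Du; reflexivity. }
  assert (dmt : forall t x, is_derive (fun s => momentum u s x) t
            (- c * (Derive_n phi 1 (x - c * t) - Derive_n phi 3 (x - c * t)))).
  { intros t x; apply is_derive_ext with (fun s => m (x - c * s)); [intros; symmetry; apply Em |].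
    apply (is_derive_comp m (fun s => x - c * s)); [apply dm | auto_derive; [trivial | ring]]. }
  assert (dmx : forall t x, is_derive (momentum u t) x
            (Derive_n phi 1 (x - c * t) - Derive_n phi 3 (x - c * t))).
  { intros t x; apply is_derive_ext with (fun y => m (y - c * t)); [intros; symmetry; apply Em |].
    evar_last;
      [apply (is_derive_comp m (fun y => y - c * t));
        [apply dm | auto_derive; [trivial | reflexivity]] |].
    apply Rmult_1_l. }
  assert (residual : forall t x,
    Derive (fun s => momentum u s x) t + 2 * k * Derive (u t) x
      + 3 * momentum u t x * Derive (u t) x + u t x * Derive (momentum u t) x =
    (phi (x - c * t) - c) * (Derive_n phi 1 (x - c * t) - Derive_n phi 3 (x - c * t))
      + (3 * m (x - c * t) + 2 * k) * Derive_n phi 1 (x - c * t)).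
  { intros t x; set (dm' := Derive_n phi 1 (x - c * t) - Derive_n phi 3 (x - c * t)).
    assert (et : Derive (fun s => momentum u s x) t = - c * dm') by apply is_derive_unique, dmt.
    assert (ex : Derive (momentum u t) x = dm') by apply is_derive_unique, dmx.
    rewrite et, ex, Em.
    change (Derive (u t) x) with (Derive_n (u t) 1 x); rewrite Du; unfold u; ring. }
  split.
  (* The equation is only available for positive times; at time 1 and position [x + c] the moving
     coordinate is [x]. *)
  - intros h x; destruct (h 1 (x + c) Rlt_0_1) as [_ [_ e]].
    fold u in e; rewrite residual in e.
    replace (x + c - c * 1) with x in e by ring; exact e.
  - intros h t x _; fold u; split; [intros; apply Eu | split; [eexists; apply dmt |]].
    rewrite residual; apply h.
Qed.

(** * Uniqueness for second-order initial value problems *)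

(** [E y * exp (- K * y)] is nonincreasing, which settles [x > 0]; [E y * exp (K * y)] is
    nondecreasing, which settles [x < 0]. *)
Lemma gronwall_zero (E dE : R -> R) (K : R) :
  (forall x, is_derive E x (dE x)) -> (forall x, 0 <= E x) ->
  (forall x, Rabs (dE x) <= K * E x) -> E 0 = 0 -> forall x, E x = 0.
Proof.
  intros hd hpos hb h0 x.
  assert (weighted : forall s t, is_derive (fun y => E y * exp (s * y)) t
            ((dE t + s * E t) * exp (s * t))).
  { intros s t; assert (h := hd t).
    auto_derive; [eexists; apply h |].
    assert (eh : Derive (fun y => E y) t = dE t) by apply is_derive_unique, h.
    rewrite eh; ring. }
  assert (hb' : forall t, - (K * E t) <= dE t <= K * E t)
    by (intros t; apply Rabs_le_between, hb).
  destruct (Rtotal_order 0 x) as [hx | [<- | hx]]; [| exact h0 |].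
  - destruct (mean_value_lt _ _ (weighted (- K)) 0 x hx) as [t [_ e]].
    rewrite h0 in e; assert (p := exp_pos (- K * t)); assert (q := exp_pos (- K * x)).
    specialize (hb' t); specialize (hpos x).
    assert ((dE t + - K * E t) * exp (- K * t) <= 0) by nra. nra.
  - destruct (mean_value_lt _ _ (weighted K) x 0 hx) as [t [_ e]].
    rewrite h0 in e; assert (p := exp_pos (K * t)); assert (q := exp_pos (K * x)).
    specialize (hb' t); specialize (hpos x).
    assert (0 <= (dE t + K * E t) * exp (K * t)) by nra. nra.
Qed.

(** Gronwall for the squared distance in the phase plane, with rate [1 + L]. The Lipschitz bound is
    asked only along the two solutions, because it will be applied to a force with a pole. *)
Lemma second_order_uniqueness (F f f1 g g1 : R -> R) (L : R) :
  (forall x, is_derive f x (f1 x)) -> (forall x, is_derive f1 x (F (f x))) ->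
  (forall x, is_derive g x (g1 x)) -> (forall x, is_derive g1 x (F (g x))) ->
  0 <= L -> (forall x, Rabs (F (f x) - F (g x)) <= L * Rabs (f x - g x)) ->
  f 0 = g 0 -> f1 0 = g1 0 -> forall x, f x = g x.
Proof.
  intros df df1 dg dg1 hL hlip e0 e1 x.
  set (E := fun x => (f x - g x) ^ 2 + (f1 x - g1 x) ^ 2).
  assert (hE : E x = 0).
  { apply gronwall_zero with
      (dE := fun x => 2 * (f1 x - g1 x) * ((f x - g x) + (F (f x) - F (g x)))) (K := 1 + L);
      unfold E.
    - intros y; assert (h1 := df y); assert (h2 := df1 y);
        assert (h3 := dg y); assert (h4 := dg1 y).
      auto_derive; [repeat split; eexists; eassumption |].
      assert (e1' : Derive (fun t => f t) y = f1 y) by apply is_derive_unique, h1.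
      assert (e2' : Derive (fun t => f1 t) y = F (f y)) by apply is_derive_unique, h2.
      assert (e3' : Derive (fun t => g t) y = g1 y) by apply is_derive_unique, h3.
      assert (e4' : Derive (fun t => g1 t) y = F (g y)) by apply is_derive_unique, h4.
      rewrite e1', e2', e3', e4'; ring.
    - intros y; apply Rplus_le_le_0_compat; apply pow2_ge_0.
    - intros y; specialize (hlip y).
      rewrite 2 Rabs_mult, (Rabs_right 2), <- (pow2_abs (f y - g y)), <- (pow2_abs (f1 y - g1 y)) by lra.
      assert (tri := Rabs_triang (f y - g y) (F (f y) - F (g y))).
      assert (p := Rabs_pos (f y - g y)); assert (q := Rabs_pos (f1 y - g1 y)).
      revert p q hlip tri; generalize (Rabs (f y - g y)) (Rabs (f1 y - g1 y)).
      intros a b ha hb hl ht.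
      apply Rle_trans with (2 * b * ((1 + L) * a)); [apply Rmult_le_compat_l; lra |].
      assert (0 <= (1 + L) * (a - b) ^ 2) by (apply Rmult_le_pos; [lra | apply pow2_ge_0]); nra.
    - rewrite e0, e1; ring. }
  unfold E in hE; assert (p := pow2_ge_0 (f x - g x)); assert (q := pow2_ge_0 (f1 x - g1 x)).
  assert (hz : f x - g x = 0) by (apply Rsqr_0_uniq; rewrite Rsqr_pow2; lra); lra.
Qed.

(** * The force law and the roots of the energy *)

(** The once integrated profile equation solved for the second derivative; the constant is the one
    for which 0 is a rest point. *)
Definition force (c k u : R) : R := u + 2 * k / 3 - 2 * k / 3 * c ^ 3 / (c - u) ^ 3.

(** With [a] and [b] the reciprocals of [c - u] and [c - v], one has [a - b = a * b * (u - v)], and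
    [a ^ 3 - b ^ 3] factors through [a - b]. Staying below [M < c] bounds both reciprocals by
    [q]. *)
Lemma force_lipschitz (c k M u v : R) :
  M < c -> u <= M -> v <= M ->
  Rabs (force c k u - force c k v)
    <= (1 + Rabs (2 * k / 3 * c ^ 3) * (3 * (/ (c - M)) ^ 4)) * Rabs (u - v).
Proof.
  intros hM hu hv; unfold force.
  set (A := 2 * k / 3 * c ^ 3); set (q := / (c - M)).
  set (a := / (c - u)); set (b := / (c - v)).
  assert (ha : 0 < a <= q) by (unfold a, q; split; [apply Rinv_0_lt_compat | apply Rinv_le_contravar]; lra).
  assert (hb : 0 < b <= q) by (unfold b, q; split; [apply Rinv_0_lt_compat | apply Rinv_le_contravar]; lra).
  replace (u + 2 * k / 3 - A / (c - u) ^ 3 - (v + 2 * k / 3 - A / (c - v) ^ 3))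
    with ((1 - A * (a * b * (a * a + a * b + b * b))) * (u - v))
    by (unfold a, b; field; lra).
  rewrite Rabs_mult; apply Rmult_le_compat_r; [apply Rabs_pos |].
  apply Rle_trans with (1 + Rabs A * (a * b * (a * a + a * b + b * b))).
  - eapply Rle_trans; [apply Rabs_triang |].
    rewrite Rabs_R1, Rabs_Ropp, Rabs_mult.
    rewrite (Rabs_right (a * _ * _)); [lra |].
    apply Rle_ge; repeat apply Rmult_le_pos || apply Rplus_le_le_0_compat; lra.
  - apply Rplus_le_compat_l, Rmult_le_compat_l; [apply Rabs_pos |].
    assert (aa : 0 <= a * a <= q * q) by (split; [nra | apply Rmult_le_compat; lra]).
    assert (ab : 0 <= a * b <= q * q) by (split; [nra | apply Rmult_le_compat; lra]).
    assert (bb : 0 <= b * b <= q * q) by (split; [nra | apply Rmult_le_compat; lra]).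
    replace (3 * q ^ 4) with (q * q * (3 * (q * q))) by ring.
    apply Rmult_le_compat; lra.
Qed.

(** Differentiating the force law yields the third derivative; the profile equation then becomes an
    algebraic identity. *)
Lemma traveling_wave_of_force (c k : R) (phi : R -> R) :
  smooth phi -> (forall x, phi x < c) ->
  (forall x, Derive_n phi 2 x = force c k (phi x)) -> traveling_wave k c phi.
Proof.
  intros hs hc h2; apply traveling_wave_ode; [exact hs |]; intros x.
  assert (hx := hc x); assert (d := smooth_is_derive phi 0 x hs).
  assert (h3 : Derive_n phi 3 x = (1 - 2 * k * c ^ 3 / (c - phi x) ^ 4) * Derive_n phi 1 x).
  { change (Derive (Derive_n phi 2) x = (1 - 2 * k * c ^ 3 / (c - phi x) ^ 4) * Derive_n phi 1 x).
    rewrite (Derive_ext _ _ x h2); apply is_derive_unique.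
    unfold force; auto_derive.
    - repeat split; try (eexists; apply d).
      repeat apply Rmult_integral_contrapositive_currified; lra.
    - change (Derive (fun x => phi x) x) with (Derive_n phi 1 x); field; lra. }
  rewrite h3, h2; unfold force; field; lra.
Qed.

(** [M] and [N] are the roots of the quadratic with the stated sum and product, and [d] is a quarter
    of its discriminant. *)
Lemma amplitude_exists (c k : R) :
  0 < 2 * k -> 2 * k < c ->
  exists M N, (c - 2 * k) / 4 < M < c - 2 * k /\ c < N /\
    M + N = 2 * c - 4 * k / 3 /\ M * N = c * (c - 2 * k).
Proof.
  intros hk hc.
  set (d := 4 * k ^ 2 / 9 + 2 * k * c / 3).
  assert (hd : 0 <= d) by (unfold d; nra).
  assert (s2 := sqrt_sqrt d hd); assert (s0 := sqrt_pos d).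
  exists (c - 2 * k / 3 - sqrt d), (c - 2 * k / 3 + sqrt d).
  unfold d in s2 at 3; clearbody d.
  (* This is [M < c - 2 * k], and it also gives [c < N]; the next bound is the lower bound on [M].
     After squaring, both follow from [2 * k < c]. *)
  assert (4 * k / 3 < sqrt d) by nra.
  assert (sqrt d < 3 * c / 4 - k / 6) by nra.
  repeat split; try lra; nra.
Qed.

(** * First integrals and decay at infinity *)

Lemma is_lim_p_infty_eps (f : R -> R) (l eps : R) :
  is_lim f p_infty l -> 0 < eps -> exists A, forall x, A < x -> Rabs (f x - l) < eps.
Proof. intros h he; apply is_lim_spec in h; exact (h (mkposreal eps he)). Qed.

(** The mean value theorem on a unit interval far out gives such a point. Only single points are
    claimed, since the derivative of a convergent function may oscillate. *)
Lemma derivative_small_at_infinity (f df : R -> R) (l : R) :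
  (forall x, is_derive f x (df x)) -> is_lim f p_infty l ->
  forall eps A, 0 < eps -> exists x, A < x /\ Rabs (df x) < eps.
Proof.
  intros hd hl eps A he.
  destruct (is_lim_p_infty_eps f l (eps / 2) hl) as [B hB]; [lra |].
  set (x := Rmax A B + 1).
  assert (hA := Rmax_l A B); assert (hB' := Rmax_r A B).
  destruct (mean_value_lt f df hd x (x + 1)) as [z [hz e]]; [lra |].
  exists z; split; [unfold x in hz; lra |].
  replace (df z) with ((f (x + 1) - l) - (f x - l)) by lra.
  assert (b1 := hB x); assert (b2 := hB (x + 1)).
  eapply Rle_lt_trans; [apply Rabs_triang |].
  rewrite Rabs_Ropp; unfold x in *; lra.
Qed.

(** The unit increment of [f] tends to 0, so its derivative is small at far points. That derivative
    is an increment of [f'], hence a value of [f''] nearby, which is close to [L]. *)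
Lemma second_derivative_limit_zero (f : R -> R) (l L : R) :
  smooth f -> is_lim f p_infty l -> is_lim (Derive_n f 2) p_infty L -> L = 0.
Proof.
  intros hs hl hL.
  assert (d := fun n x => smooth_is_derive f n x hs).
  assert (dg : forall x, is_derive (fun x => f (x + 1) - f x) x (Derive_n f 1 (x + 1) - Derive_n f 1 x)).
  { intros x; apply (@is_derive_minus R_AbsRing R_NormedModule (fun x => f (x + 1))); [| apply (d 0%nat)].
    evar_last;
      [apply (is_derive_comp f (fun x => x + 1));
        [apply (d 0%nat) | auto_derive; [trivial | reflexivity]] |].
    apply Rmult_1_l. }
  assert (lg : is_lim (fun x => f (x + 1) - f x) p_infty 0).
  { apply is_lim_spec; intros [eps he]; simpl.
    destruct (is_lim_p_infty_eps f l (eps / 2) hl) as [B hB]; [lra |].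
    exists B; intros x hx.
    assert (b1 := hB x hx); assert (b2 := hB (x + 1) ltac:(lra)).
    apply Rabs_lt_between in b1, b2; apply Rabs_lt_between; lra. }
  destruct (Req_dec L 0) as [e | n]; [exact e | exfalso].
  assert (hp := Rabs_pos_lt L n).
  destruct (is_lim_p_infty_eps _ L (Rabs L / 2) hL) as [B hB]; [lra |].
  destruct (derivative_small_at_infinity _ _ _ dg lg (Rabs L / 2) B) as [x [hx sx]]; [lra |].
  destruct (mean_value_lt _ _ (d 1%nat) x (x + 1)) as [z [hz e]]; [lra |].
  specialize (hB z ltac:(lra)).
  replace (x + 1 - x) with 1 in e by ring; rewrite e, Rmult_1_r in sx.
  revert hB sx; unfold Rabs; repeat destruct Rcase_abs; lra.
Qed.

Lemma solitary_wave_force (k c : R) (psi : R -> R) :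
  0 < 2 * k -> 2 * k < c -> smooth psi -> traveling_wave k c psi -> is_lim psi p_infty 0 ->
  forall x, psi x < c /\ Derive_n psi 2 x = force c k (psi x).
Proof.
  intros hk hc hs htw hlim.
  assert (d := fun n x => smooth_is_derive psi n x hs).
  assert (ode := proj1 (traveling_wave_ode k c psi hs) htw).
  set (I := fun x => (c - psi x) ^ 3 * (psi x - Derive_n psi 2 x + 2 * k / 3)).
  assert (dI : forall x, is_derive I x 0).
  { intros x; assert (d0 := d 0%nat x); assert (d2 := d 2%nat x).
    assert (e0 : Derive (fun t => psi t) x = Derive_n psi 1 x) by reflexivity.
    specialize (ode x).
    unfold I; set (g := Derive_n psi 2) in *.
    assert (e2 : Derive (fun t => g t) x = Derive_n psi 3 x) by reflexivity.
    auto_derive; [repeat split; eexists; eassumption |].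
    rewrite e0, e2.
    (* The derivative of [I] is [- (c - psi) ^ 2] times the left side of the profile equation. *)
    transitivity ((c - psi x) ^ 2 *
      - ((psi x - c) * (Derive_n psi 1 x - Derive_n psi 3 x) +
         (3 * (psi x - g x) + 2 * k) * Derive_n psi 1 x)); [field | rewrite ode; ring]. }
  set (K := I 0).
  assert (hI : forall x, I x = K) by (intros x; apply zero_derivative_constant, dI).
  assert (h2 : forall x, psi x <> c -> Derive_n psi 2 x = psi x + 2 * k / 3 - K / (c - psi x) ^ 3).
  { intros x hx; rewrite <- (hI x); unfold I; field; lra. }
  (* As [psi] tends to 0, its second derivative tends to [2 * k / 3 - K / c ^ 3], and such a limit
     must be 0. *)
  assert (hK : K = 2 * k / 3 * c ^ 3).
  { assert (z : 2 * k / 3 - K / c ^ 3 = 0).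
    { apply (second_derivative_limit_zero psi 0); [exact hs | exact hlim |].
      apply is_lim_ext_loc with (fun x => psi x + 2 * k / 3 - K / (c - psi x) ^ 3).
      - destruct (is_lim_p_infty_eps psi 0 c hlim) as [A hA]; [lra |].
        exists A; intros x hx; specialize (hA x hx); apply Rabs_lt_between in hA.
        symmetry; apply h2; lra.
      - replace (2 * k / 3 - K / c ^ 3) with (0 + 2 * k / 3 - K / (c - 0) ^ 3) by (field; lra).
        apply (is_lim_comp_continuous psi (fun y => y + 2 * k / 3 - K / (c - y) ^ 3)); [exact hlim |].
        apply (@ex_derive_continuous R_AbsRing R_NormedModule); auto_derive.
        repeat split; repeat apply Rmult_integral_contrapositive_currified; lra. }
    apply Rminus_diag_uniq_sym in z; rewrite <- z; field; lra. }
  (* At a point where [psi = c] the integral [I] would vanish, but [K > 0]. As [psi < c] far to the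
     right, the intermediate value theorem then excludes values above [c]. *)
  assert (ne : forall x, psi x <> c).
  { intros x e; assert (h := hI x); unfold I in h; rewrite e, Rminus_diag, hK in h.
    assert (0 < c ^ 3) by (apply pow_lt; lra); nra. }
  assert (lt : forall x, psi x < c).
  { intros x; destruct (Rtotal_order (psi x) c) as [h | [h | h]]; [exact h | now apply ne in h |].
    exfalso; destruct (is_lim_p_infty_eps psi 0 c hlim) as [A hA]; [lra |].
    set (y := Rmax A x + 1); assert (hl := Rmax_l A x); assert (hr := Rmax_r A x).
    specialize (hA y ltac:(unfold y; lra)); apply Rabs_lt_between in hA.
    destruct (IVT_cor (fun t => psi t - c) x y) as [t [_ et]]; [| unfold y; lra | nra |].
    - intros t; apply continuity_pt_filterlim,
        (@ex_derive_continuous R_AbsRing R_NormedModule (fun t => psi t - c)).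
      assert (d0 := d 0%nat t); auto_derive; eexists; apply d0.
    - apply (ne t); lra. }
  intros x; split; [apply lt |].
  rewrite h2 by apply ne; rewrite hK; reflexivity.
Qed.

(** Conservation of energy: [V] is the primitive of twice the force with [V 0 = 0], so
    [psi'^2 - V psi] is constant. The constant is 0 because points with [psi] and [psi'] both small
    exist arbitrarily far out. The sum and product of [M] and [N] then factor [V]. *)
Lemma force_energy (c k M N : R) (psi : R -> R) :
  0 < c -> M + N = 2 * c - 4 * k / 3 -> M * N = c * (c - 2 * k) ->
  smooth psi -> is_lim psi p_infty 0 ->
  (forall x, psi x < c /\ Derive_n psi 2 x = force c k (psi x)) ->
  forall x, Derive_n psi 1 x ^ 2
    = psi x ^ 2 * ((M - psi x) * (N - psi x)) / (c - psi x) ^ 2.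
Proof.
  intros hc hsum hprod hs hlim hf.
  assert (d := fun n x => smooth_is_derive psi n x hs).
  set (V := fun u => u ^ 2 + 4 * k / 3 * u - 2 * k / 3 * c ^ 3 / (c - u) ^ 2 + 2 * k * c / 3).
  assert (V0 : V 0 = 0) by (unfold V; field; lra).
  set (E := fun x => Derive_n psi 1 x ^ 2 - V (psi x)).
  assert (dE : forall x, is_derive E x 0).
  { intros x; assert (d0 := d 0%nat x); assert (d1 := d 1%nat x).
    assert (e0 : Derive (fun t => psi t) x = Derive_n psi 1 x) by reflexivity.
    destruct (hf x) as [hx h2].
    unfold E, V; set (g := Derive_n psi 1) in *.
    assert (e1 : Derive (fun t => g t) x = Derive_n psi 2 x) by reflexivity.
    auto_derive; [repeat split; try (eexists; eassumption);
      repeat apply Rmult_integral_contrapositive_currified; lra |].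
    rewrite e0, e1, h2; unfold force; field; lra. }
  assert (cE := zero_derivative_constant E dE).
  assert (E0 : E 0 = 0).
  { destruct (Req_dec (E 0) 0) as [e | n]; [exact e | exfalso].
    set (r := Rabs (E 0) / 2).
    assert (hr : 0 < r) by (apply Rabs_pos_lt in n; unfold r; lra).
    assert (lV : is_lim (fun x => V (psi x)) p_infty 0).
    { rewrite <- V0; apply is_lim_comp_continuous; [exact hlim |].
      apply (@ex_derive_continuous R_AbsRing R_NormedModule); unfold V; auto_derive.
      repeat split; repeat apply Rmult_integral_contrapositive_currified; lra. }
    destruct (is_lim_p_infty_eps _ 0 r lV hr) as [A hA].
    (* A derivative below both 1 and [r] in absolute value has its square below [r]. *)
    destruct (derivative_small_at_infinity psi _ 0 (d 0%nat) hlim (Rmin 1 r) A)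
      as [x [hx sx]]; [apply Rmin_pos; lra |].
    specialize (hA x hx); rewrite Rminus_0_r in hA.
    assert (s1 := Rmin_l 1 r); assert (s2 := Rmin_r 1 r).
    assert (hsq : Rabs (Derive_n psi 1 x ^ 2) < r).
    { rewrite <- RPow_abs; assert (p := Rabs_pos (Derive_n psi 1 x)); nra. }
    assert (h : Rabs (E 0) < r + r).
    { rewrite (cE 0 x); unfold E; eapply Rle_lt_trans; [apply Rabs_triang |].
      rewrite Rabs_Ropp; lra. }
    unfold r in h; lra. }
  intros x; destruct (hf x) as [hx _].
  assert (e : E x = 0) by (rewrite <- E0; apply cE).
  unfold E in e; apply Rminus_diag_uniq in e; rewrite e; unfold V.
  replace N with (2 * c - 4 * k / 3 - M) in * by lra.
  apply Rmult_eq_reg_r with ((c - psi x) ^ 2); [| apply pow_nonzero; lra].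
  field_simplify; [nra | lra | lra].
Qed.

(** * Height of the crest *)

(** At the maximum the derivative vanishes, so the energy leaves the values 0, [M] and [N];
    positivity and [psi < c < N] single out [M]. *)
Lemma solitary_wave_crest (k c M N : R) (psi : R -> R) :
  0 < 2 * k -> 2 * k < c -> M < c -> c < N ->
  M + N = 2 * c - 4 * k / 3 -> M * N = c * (c - 2 * k) ->
  solitary_wave k c psi ->
  exists xi0, psi xi0 = M /\ Derive_n psi 1 xi0 = 0 /\ forall x, psi x <= M.
Proof.
  intros hk hc hM hN hsum hprod [hs [htw [xi0 [[_ hmax] [hp [_ [_ hdec]]]]]]].
  assert (hf := solitary_wave_force k c psi hk hc hs htw hp).
  assert (en := force_energy c k M N psi ltac:(lra) hsum hprod hs hp hf xi0).
  assert (d0 : Derive_n psi 1 xi0 = 0).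
  { assert (d := smooth_is_derive psi 0 xi0 hs); apply is_derive_Reals in d.
    set (pr := exist _ _ d : derivable_pt psi xi0).
    apply (deriv_maximum psi (xi0 - 1) (xi0 + 1) xi0 pr); intros; try lra; apply hmax. }
  (* Were [psi (xi0 + 1) <= 0], strict decrease would keep [psi] below the negative number
     [psi (xi0 + 2)] from there on, against the limit 0. *)
  assert (pos : 0 < psi xi0).
  { apply Rlt_le_trans with (psi (xi0 + 1)); [| apply hmax].
    apply Rnot_le_lt; intros neg.
    assert (lt := hdec (xi0 + 1) (xi0 + 2) ltac:(lra) ltac:(lra)).
    destruct (is_lim_p_infty_eps psi 0 (- psi (xi0 + 2)) hp) as [A hA]; [lra |].
    set (y := Rmax A (xi0 + 2) + 1).
    assert (hl := Rmax_l A (xi0 + 2)); assert (hr := Rmax_r A (xi0 + 2)).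
    specialize (hA y ltac:(unfold y; lra)); apply Rabs_lt_between in hA.
    assert (lt' := hdec (xi0 + 2) y ltac:(lra) ltac:(unfold y; lra)); lra. }
  assert (hpc := proj1 (hf xi0)).
  assert (e : psi xi0 = M).
  { rewrite d0 in en.
    assert (z : psi xi0 ^ 2 * ((M - psi xi0) * (N - psi xi0)) = 0).
    { apply Rmult_eq_reg_r with (/ (c - psi xi0) ^ 2);
        [lra | apply Rinv_neq_0_compat, pow_nonzero; lra]. }
    apply Rmult_integral in z; destruct z as [z | z]; [nra |].
    apply Rmult_integral in z; destruct z; lra. }
  exists xi0; split; [exact e | split; [exact d0 | intros x; rewrite <- e; apply hmax]].
Qed.

(** * Hyperbolic functions and the explicit profile *)

Lemma is_derive_sinh (x : R) : is_derive sinh x (cosh x).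
Proof. apply is_derive_Reals, derivable_pt_lim_sinh. Qed.

Lemma is_derive_cosh (x : R) : is_derive cosh x (sinh x).
Proof. apply is_derive_Reals, derivable_pt_lim_cosh. Qed.

(** A linear bound suffices later: it bounds [phi x * Rabs x], which forces decay. *)
Lemma cosh_lower (x : R) : (1 + Rabs x) / 2 <= cosh x.
Proof.
  unfold cosh; assert (h1 := exp_ineq1_le x); assert (h2 := exp_ineq1_le (- x)).
  assert (p1 := exp_pos x); assert (p2 := exp_pos (- x)).
  unfold Rabs; destruct Rcase_abs; lra.
Qed.

Lemma cosh_sq (x : R) : cosh x ^ 2 = 1 + sinh x ^ 2.
Proof.
  assert (e : exp x * exp (- x) = 1) by (rewrite <- exp_plus, Rplus_opp_r; apply exp_0).
  unfold cosh, sinh; nra.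
Qed.

Lemma cosh_ge_1 (x : R) : 1 <= cosh x.
Proof.
  assert (h := cosh_sq x); assert (l := cosh_lower x); assert (p := Rabs_pos x).
  assert (q := pow2_ge_0 (sinh x)); nra.
Qed.

(* In the variable [z] with [z' = sqrt (M N) / (c - phi)], the first integral
   [phi'^2 = phi^2 (M - phi) (N - phi) / (c - phi)^2] becomes the elementary equation
   [(d phi / d z)^2 = phi^2 (M - phi) (N - phi) / (M N)], solved by this profile. *)
Definition profile (M N z : R) : R := 2 * (M * N) / (M + N + (N - M) * cosh z).

Lemma profile_bounds (M N z : R) : 0 < M -> M < N -> 0 < profile M N z <= M.
Proof.
  intros hM hN; unfold profile; assert (h := cosh_ge_1 z).
  assert (p : 2 * N <= M + N + (N - M) * cosh z) by nra.
  assert (0 < M * N) by nra.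
  split; [apply Rdiv_lt_0_compat; lra |].
  apply Rle_div_l; [lra | nra].
Qed.

Lemma profile_derive (M N z : R) :
  0 < M -> M < N ->
  is_derive (profile M N) z (- (N - M) / (2 * (M * N)) * profile M N z ^ 2 * sinh z).
Proof.
  intros hM hN; assert (h := cosh_ge_1 z).
  assert (p : 0 < M + N + (N - M) * cosh z) by nra.
  assert (0 < M * N) by nra.
  unfold profile; auto_derive; [lra |].
  field; lra.
Qed.

Lemma is_lim_infty_of_abs (f g : R -> R) (A : R) :
  0 < A -> (forall x, 0 <= f x) -> (forall x, f x * Rabs x <= A) ->
  is_lim f p_infty 0 /\ is_lim f m_infty 0.
Proof.
  intros hA h0 h; split; apply is_lim_spec; intros [eps he]; simpl;
    [exists (A / eps) | exists (- (A / eps))]; intros x hx;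
    specialize (h0 x); specialize (h x);
    assert (hAe : 0 < A / eps) by (apply Rdiv_lt_0_compat; lra);
    assert (hq : A / eps < Rabs x)
      by (unfold Rabs; destruct Rcase_abs; lra);
    apply Rlt_div_l in hq; try lra;
    rewrite Rminus_0_r, Rabs_right by lra; apply Rnot_le_lt; intros n; nra.
Qed.

(** * The profile along the change of variable *)

(** When [Y' = b / (c - profile M N Y)], the derivative of each generator is a polynomial in the
    generators. The class is therefore closed under differentiation, as
    [smooth_of_derivation_closed] asks. *)
Inductive profile_algebra (c M N : R) (Y : R -> R) : (R -> R) -> Prop :=
| pa_const a : profile_algebra c M N Y (fun _ => a)
| pa_sinh : profile_algebra c M N Y (fun x => sinh (Y x))
| pa_cosh : profile_algebra c M N Y (fun x => cosh (Y x))
| pa_profile : profile_algebra c M N Y (fun x => profile M N (Y x))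
| pa_inv : profile_algebra c M N Y (fun x => / (c - profile M N (Y x)))
| pa_plus f g : profile_algebra c M N Y f -> profile_algebra c M N Y g ->
    profile_algebra c M N Y (fun x => f x + g x)
| pa_mult f g : profile_algebra c M N Y f -> profile_algebra c M N Y g ->
    profile_algebra c M N Y (fun x => f x * g x).

Section Profile_curve.

Variables (c M N b : R) (Y : R -> R).
Hypothesis M_pos : 0 < M.
Hypothesis M_lt_c : M < c.
Hypothesis c_lt_N : c < N.
Hypothesis Y_derive : forall x, is_derive Y x (b * / (c - profile M N (Y x))).

Let phi x := profile M N (Y x).

Lemma profile_curve_bounds x : 0 < phi x <= M.
Proof. apply profile_bounds; lra. Qed.

(** The chain rule, written with products and reciprocals only, so that the derivative is visibly in
    [profile_algebra]. *)
Lemma profile_curve_derive x :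
  is_derive phi x
    (- (N - M) / (2 * (M * N)) * b * (phi x * phi x) * sinh (Y x) * / (c - phi x)).
Proof.
  evar_last; [apply (is_derive_comp (profile M N) Y); [apply profile_derive; lra | apply Y_derive] |].
  unfold scal; simpl; unfold mult; simpl; fold (phi x); assert (p := profile_curve_bounds x).
  field; lra.
Qed.

Lemma profile_curve_inv_derive x :
  is_derive (fun x => / (c - phi x)) x
    ((- (N - M) / (2 * (M * N)) * b * (phi x * phi x) * sinh (Y x) * / (c - phi x))
      * (/ (c - phi x) * / (c - phi x))).
Proof.
  assert (d := profile_curve_derive x); assert (p := profile_curve_bounds x).
  assert (e := is_derive_unique _ _ _ d : Derive (fun t => phi t) x = _).
  auto_derive; [repeat split; [eexists; apply d | lra] |].
  rewrite e; field; lra.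
Qed.

Lemma profile_curve_smooth : smooth phi.
Proof.
  apply (smooth_of_derivation_closed (profile_algebra c M N Y)); [| constructor].
  intros f hf; induction hf
    as [a | | | | | f g hf [f' [hf' df]] hg [g' [hg' dg]] | f g hf [f' [hf' df]] hg [g' [hg' dg]]].
  - exists (fun _ => 0); split; [constructor | intros x; apply (@is_derive_const R_AbsRing R_NormedModule)].
  - exists (fun x => (b * / (c - profile M N (Y x))) * cosh (Y x)); split; [repeat constructor |].
    intros x; apply (is_derive_comp sinh Y); [apply is_derive_sinh | apply Y_derive].
  - exists (fun x => (b * / (c - profile M N (Y x))) * sinh (Y x)); split; [repeat constructor |].
    intros x; apply (is_derive_comp cosh Y); [apply is_derive_cosh | apply Y_derive].
  - eexists; split; [| apply profile_curve_derive].
    apply pa_mult; [| apply pa_inv]; apply pa_mult; [| apply pa_sinh].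
    apply pa_mult; [apply pa_const | apply pa_mult; apply pa_profile].
  - eexists; split; [| apply profile_curve_inv_derive].
    apply pa_mult; [| apply pa_mult; apply pa_inv].
    apply pa_mult; [| apply pa_inv]; apply pa_mult; [| apply pa_sinh].
    apply pa_mult; [apply pa_const | apply pa_mult; apply pa_profile].
  - exists (fun x => f' x + g' x); split; [apply pa_plus; assumption |].
    intros x; apply (@is_derive_plus R_AbsRing R_NormedModule); auto.
  - exists (fun x => f' x * g x + f x * g' x); split;
      [apply pa_plus; apply pa_mult; assumption |].
    intros x; apply (is_derive_mult f g); auto; apply Rmult_comm.
Qed.

(** After differentiation [sinh] enters only squared, so both hyperbolic functions can be eliminated
    in favour of [phi], leaving a rational identity in the height [u]. *)
Lemma profile_curve_second_derivative k x :
  b * b = M * N -> M + N = 2 * c - 4 * k / 3 -> M * N = c * (c - 2 * k) ->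
  Derive_n phi 2 x = force c k (phi x).
Proof.
  intros hb hsum hprod.
  set (A := - (N - M) / (2 * (M * N)) * b).
  assert (e1 : forall t, Derive_n phi 1 t = A * (phi t * phi t) * sinh (Y t) * / (c - phi t))
    by (intros t; apply is_derive_unique, profile_curve_derive).
  change (Derive (Derive_n phi 1) x = force c k (phi x)).
  rewrite (Derive_ext _ _ x e1); apply is_derive_unique.
  assert (d := profile_curve_derive x); fold A in d; assert (p := profile_curve_bounds x).
  assert (ds : is_derive (fun t => sinh (Y t)) x (b * / (c - phi x) * cosh (Y x)))
    by (apply (is_derive_comp sinh Y); [apply is_derive_sinh | apply Y_derive]).
  assert (e := is_derive_unique _ _ _ d : Derive (fun t => phi t) x = _).
  assert (es := is_derive_unique _ _ _ ds : Derive (fun t => sinh (Y t)) x = _).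
  set (s := fun t => sinh (Y t)) in *.
  change (fun t => A * (phi t * phi t) * sinh (Y t) * / (c - phi t))
    with (fun t => A * (phi t * phi t) * s t * / (c - phi t)).
  auto_derive; [repeat split; try (eexists; eassumption); lra |].
  change (Derive (fun t => s t) x) with (Derive s x); rewrite e, es.
  change (sinh (Y x)) with (s x).
  (* The formula for the profile, solved for [cosh]. *)
  assert (hC : cosh (Y x) = (2 * (M * N) / phi x - (M + N)) / (N - M)).
  { unfold phi, profile; assert (h := cosh_ge_1 (Y x)); field; nra. }
  assert (hS : s x ^ 2 = cosh (Y x) ^ 2 - 1) by (unfold s; rewrite cosh_sq; ring).
  transitivity (- (N - M) / (2 * (M * N)) * (b * b) * phi x ^ 2 / (c - phi x) ^ 2 *
    (- (N - M) / (2 * (M * N)) * s x ^ 2 * (2 * phi x + phi x ^ 2 / (c - phi x))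
      + cosh (Y x))).
  { unfold A; field; nra. }
  rewrite hb, hS, hC; set (u := phi x) in *.
  (* This is half the derivative in [u] of [u ^ 2 * (M - u) * (N - u) / (c - u) ^ 2], where [M] and
     [N] enter only through their sum and product. *)
  transitivity (u * (u ^ 2 - (M + N) * u + M * N) / (c - u) ^ 2
    + u ^ 2 * (2 * u - (M + N)) / 2 / (c - u) ^ 2
    + u ^ 2 * (u ^ 2 - (M + N) * u + M * N) / (c - u) ^ 3).
  { field; lra. }
  rewrite hsum, hprod; unfold force; field; lra.
Qed.

End Profile_curve.

(** * Existence of an even solitary wave *)

Lemma profile_wave_exists (c k M N : R) :
  0 < k -> 0 < M -> M < c -> c < N ->
  M + N = 2 * c - 4 * k / 3 -> M * N = c * (c - 2 * k) ->
  exists phi,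
    solitary_wave k c phi /\
    (forall x, phi (- x) = phi x) /\ phi 0 = M /\ Derive_n phi 1 0 = 0 /\
    (forall x, phi x <= M) /\ increasing_below phi 0 /\ is_lim phi m_infty 0 /\
    smooth phi /\ forall x, Derive_n phi 2 x = force c k (phi x).
Proof.
  intros hk hM hMc hcN hsum hprod.
  assert (hMN : 0 < M * N) by nra.
  set (b := sqrt (M * N)).
  assert (hb : 0 < b) by (apply sqrt_lt_R0; exact hMN).
  assert (hbb : b * b = M * N) by (apply sqrt_sqrt; lra).
  assert (pb : forall z, 0 < profile M N z <= M) by (intros z; apply profile_bounds; lra).
  assert (peven : forall z, profile M N (- z) = profile M N z).
  { intros z; unfold profile, cosh; rewrite Ropp_involutive, (Rplus_comm (exp (- z))); reflexivity. }
  (* The function [(c - profile) / b] is even and, as the profile lies in [(0, M]], stays between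
     the two given positive constants. *)
  destruct (autonomous_solution (fun z => (c - profile M N z) / b) ((c - M) / b) (c / b))
    as [Y [dY' [oddY absY]]].
  - apply Rdiv_lt_0_compat; lra.
  - intros z; assert (d := profile_derive M N z hM ltac:(lra)).
    apply (@ex_derive_continuous R_AbsRing R_NormedModule (fun z => (c - profile M N z) / b)).
    auto_derive; repeat split; try (eexists; apply d); lra.
  - intros z; specialize (pb z); split; apply Rmult_le_compat_r;
      try (apply Rlt_le, Rinv_0_lt_compat; exact hb); lra.
  - intros z; rewrite peven; reflexivity.
  - assert (dY : forall x, is_derive Y x (b * / (c - profile M N (Y x)))).
    { intros x; evar_last; [apply dY' | specialize (pb (Y x)); field; lra]. }
    set (phi := fun x => profile M N (Y x)).
    assert (even : forall x, phi (- x) = phi x) by (intros x; unfold phi; rewrite oddY; apply peven).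
    assert (Y0 : Y 0 = 0) by (specialize (oddY 0); rewrite Ropp_0 in oddY; lra).
    assert (phi0 : phi 0 = M).
    { unfold phi, profile; rewrite Y0, cosh_0; field; lra. }
    assert (hs : smooth phi) by (apply (profile_curve_smooth c M N b); assumption).
    assert (d1 := profile_curve_derive c M N b Y hM hMc hcN dY : forall x, is_derive phi x _).
    assert (h2 : forall x, Derive_n phi 2 x = force c k (phi x))
      by (intros x; apply (profile_curve_second_derivative c M N b Y); assumption).
    assert (neg : forall x, x < 0 -> Y x < 0).
    { intros x hx; destruct (mean_value_lt Y _ dY x 0 hx) as [z [_ e]].
      specialize (pb (Y z)); rewrite Y0 in e.
      assert (0 < b * / (c - profile M N (Y z)) * (0 - x)) by
        (repeat first [lra | apply Rmult_lt_0_compat | apply Rinv_0_lt_compat]); lra. }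
    assert (incr : increasing_below phi 0).
    { intros x y hxy hy; destruct (mean_value_lt phi _ d1 x y hxy) as [z [hz e]].
      enough (0 < phi y - phi x) by lra; rewrite e; apply Rmult_lt_0_compat; [| lra].
      assert (sn : sinh (Y z) < 0) by (rewrite <- sinh_0; apply sinh_lt, neg; lra).
      fold (phi z); assert (p := pb (Y z) : 0 < phi z <= M).
      replace (_ * / _) with ((N - M) / (2 * (M * N)) * b * (phi z * phi z) * - sinh (Y z) * / (c - phi z))
        by (field; lra).
      repeat first [lra | apply Rmult_lt_0_compat | apply Rinv_0_lt_compat]. }
    (* The constant combines [phi * Rabs Y <= 4 * (M * N) / (N - M)], from [cosh_lower], with
       [Rabs x <= c / b * Rabs Y]. *)
    destruct (is_lim_infty_of_abs phi phi (4 * (M * N) / (N - M) * (c / b))) as [lp lm].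
    + apply Rmult_lt_0_compat; apply Rdiv_lt_0_compat; lra.
    + intros x; apply Rlt_le, pb.
    + intros x; assert (l := cosh_lower (Y x)); specialize (absY x).
      assert (p := Rabs_pos (Y x)); assert (q := pb (Y x)).
      apply Rle_trans with (phi x * (c / b * Rabs (Y x)));
        [apply Rmult_le_compat_l; [apply Rlt_le, q | exact absY] |].
      replace (phi x * (c / b * Rabs (Y x))) with (phi x * Rabs (Y x) * (c / b)) by ring.
      apply Rmult_le_compat_r; [apply Rlt_le, Rdiv_lt_0_compat; lra |].
      unfold phi, profile.
      assert (w : (N - M) * Rabs (Y x) <= 2 * (M + N + (N - M) * cosh (Y x))).
      { assert (w := Rmult_le_compat_l (N - M) _ _ ltac:(lra) l); lra. }
      assert (w' : 0 < (N - M) * cosh (Y x)) by (apply Rmult_lt_0_compat; lra).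
      apply -> Rle_div_r; [| lra].
      replace (2 * (M * N) / (M + N + (N - M) * cosh (Y x)) * Rabs (Y x) * (N - M))
        with (2 * (M * N) * ((N - M) * Rabs (Y x)) / (M + N + (N - M) * cosh (Y x))) by (field; lra).
      apply Rle_div_l; [lra |].
      assert (w2 := Rmult_le_compat_l (2 * (M * N)) _ _ ltac:(lra) w); lra.
    + assert (top : forall x, phi x <= M) by (intros x; apply pb).
      exists phi; repeat apply conj; try assumption.
      * apply traveling_wave_of_force; [exact hs | intros x; specialize (top x); lra | exact h2].
      * exists 0; repeat apply conj; try assumption.
        -- exists 0; reflexivity.
        -- rewrite phi0; exact top.
        -- intros x y hx hxy; rewrite <- (even x), <- (even y); apply incr; lra.
      * change (Derive phi 0 = 0); rewrite (is_derive_unique _ _ _ (d1 0)), Y0, sinh_0; ring.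
Qed.

(** * Existence, uniqueness up to translation, and height bounds *)

Theorem theorem1p1 (c k : R) (hk : 0 < 2 * k) (hc : 2 * k < c) :
  exists phi : R -> R,
    solitary_wave k c phi /\
    (forall psi : R -> R, solitary_wave k c psi ->
       exists a : R, forall xi : R, psi xi = phi (xi - a)) /\
    exists phi_max : R,
      is_max phi phi_max /\
      (c - 2 * k) / 4 < phi_max < c - 2 * k /\
      (forall xi : R, phi (- xi) = phi xi) /\
      increasing_below phi 0 /\
      is_lim phi m_infty 0 /\
      phi 0 = phi_max.
Proof.
  destruct (amplitude_exists c k hk hc) as [M [N [hM [hN [hsum hprod]]]]].
  destruct (profile_wave_exists c k M N) as
    [phi [sol [even [phi0 [dphi0 [top [incr [lm [hs h2]]]]]]]]]; try lra.
  exists phi; split; [exact sol | split].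
  - intros psi hpsi.
    destruct (solitary_wave_crest k c M N psi hk hc) as [a [pa [da ptop]]];
      [lra | lra | lra | lra | exact hpsi |].
    destruct hpsi as [ps [ptw [_ [_ [plim _]]]]].
    assert (pf := solitary_wave_force k c psi hk hc ps ptw plim).
    exists a; intros xi.
    assert (shift : forall n x, is_derive (fun x => Derive_n psi n (x + a)) x (Derive_n psi (S n) (x + a))).
    { intros n x; evar_last;
        [apply (is_derive_comp (Derive_n psi n) (fun x => x + a));
          [apply smooth_is_derive, ps | auto_derive; [trivial | reflexivity]] | apply Rmult_1_l]. }
    replace xi with (xi - a + a) at 1 by ring.
    (* With its crest moved to the origin, [psi] solves the same equation as [phi] with the same
       data: height [M] and slope 0. Both stay below [M], where the force is Lipschitz. *)
    apply (second_order_uniqueness (force c k) (fun x => psi (x + a)) (fun x => Derive_n psi 1 (x + a))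
      phi (Derive_n phi 1) (1 + Rabs (2 * k / 3 * c ^ 3) * (3 * (/ (c - M)) ^ 4))).
    + apply (shift 0%nat).
    + intros x; rewrite <- (proj2 (pf (x + a))); apply (shift 1%nat).
    + intros x; apply (smooth_is_derive phi 0 x hs).
    + intros x; rewrite <- h2; apply (smooth_is_derive phi 1 x hs).
    + assert (h := Rabs_pos (2 * k / 3 * c ^ 3)).
      assert (q : 0 <= (/ (c - M)) ^ 4) by (apply pow_le, Rlt_le, Rinv_0_lt_compat; lra).
      nra.
    + intros x; apply force_lipschitz; [lra | apply ptop | apply top].
    + rewrite Rplus_0_l, phi0; exact pa.
    + rewrite Rplus_0_l, dphi0; exact da.
  - exists M; repeat apply conj; try assumption; try lra.
    exists 0; exact phi0.
Qed.
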